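(* For any $d\geq 2$, there exists a non-empty, bounded and path-connected domain $\mathcal{X}\subset\mathbb{R}^d$ such that any probability density $\rho$ which is bounded from above and below by positive constants on $\mathcal{X}$ does not have the Hölder potential stability property.
   Context: $W_p(\mu,\nu)=\bigl(\inf_{\gamma}\int \|x-y\|^p\,d\gamma(x,y)\bigr)^{1/p}$, the infimum being over couplings $\gamma$ of $\mu$ and $\nu$. For a fixed absolutely continuous probability measure $\rho$ on $\mathbb{R}^d$ with finite second moment, supported in $\mathcal{X}$, and a probability measure $\mu$ with finite second moment: the Brenier map $T_\mu$ is the ($\rho$-a.e. unique) optimal transport map from $\rho$ to $\mu$ for the quadratic cost $\|x-y\|^2$; by Brenier's theorem it is the gradient of a convex function. The Brenier potential $\phi_\mu$ is the lower semi-continuous convex function $\phi_\mu\in L^2(\rho)$ such that $T_\mu=\nabla\phi_\mu$ ($\rho$-a.e.) and $\int_{\mathcal{X}}\phi_\mu\,d\rho=0$ (unique as an element of $L^2(\rho)$ when, as here, the support of $\rho$ is connected). An absolutely continuous probability measure $\rho$ on $\mathbb{R}^d$ has the Hölder potential stability property if there exist $C,q>0$ and $p\in[1,\infty)$ such that for any probability measures $\mu,\nu$ supported in the (closed) unit ball of $\mathbb{R}^d$, $\|\phi_\mu-\phi_\nu\|_{L^2(\rho)}\leq C\,W_p(\mu,\nu)^q$. *)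

(* Defs.v *)
From HB Require Import structures.
From mathcomp Require Import all_boot all_order all_algebra.
From mathcomp Require Import all_classical all_reals all_analysis.
From mathcomp Require Import measurable_realfun.

Set Implicit Arguments.
Unset Strict Implicit.
Unset Printing Implicit Defensive.

Import Order.TTheory GRing.Theory Num.Theory.
Import numFieldNormedType.Exports.

Local Open Scope classical_set_scope.
Local Open Scope ring_scope.

(* The Borel sigma-algebra of R^n. The library topology on matrices is the one
   of the sup norm, hence the Euclidean one. *)
Section borel_matrix.
Context (R : realType) (m n : nat).

Let borel : set (set 'M[R]_(m, n)) := <<s @open 'M[R]_(m, n) >>.

Let borel0 : borel set0.
Proof. exact: sigma_algebra0. Qed.

Let borelC A : borel A -> borel (~` A).
Proof. exact: sigma_algebraC. Qed.

Let borel_bigcup (F : (set 'M[R]_(m, n))^nat) :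
  (forall i, borel (F i)) -> borel (\bigcup_i F i).
Proof. exact: sigma_algebra_bigcup. Qed.

HB.instance Definition _ :=
  @isMeasurable.Build (sigma_display (@open 'M[R]_(m, n))) 'M[R]_(m, n)
    borel borel0 borelC borel_bigcup.

End borel_matrix.

Lemma open_measurable_mx (R : realType) m n (U : set 'M[R]_(m, n)) :
  open U -> measurable U.
Proof. by move=> oU; exact: sub_sigma_algebra. Qed.

Section lebesgue_rV.
Context (R : realType).

Definition rVcons n (x : measurableTypeR R * 'rV[R]_n) : 'rV[R]_n.+1 :=
  row_mx (x.1 : R)%:M x.2 : 'rV[R]_(1 + n).

Lemma open_bigcup_rat_ball n (U : set 'rV[R]_n) : open U ->
  U = \bigcup_(qk in [set qk : 'rV[rat]_n * nat |
         ball (map_mx ratr qk.1 : 'rV[R]_n) (qk.2.+1%:R^-1 : R) `<=` U])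
        ball (map_mx ratr qk.1 : 'rV[R]_n) (qk.2.+1%:R^-1 : R).
Proof.
move=> oU; apply/seteqP; split; last by move=> x [qk /= /[apply]].
move=> x Ux.
have /nbhs_ballP[e /= e0 xeU] : nbhs x U by exact: open_nbhs_nbhs.
have [k ke] : exists k : nat, k.+1%:R^-1 < e / 2.
  have e20 : 0 < e / 2 by rewrite divr_gt0.
  have := near_infty_natSinv_lt (PosNum e20).
  by move=> [k _ /(_ k (leqnn k))]; exists k.
have k0 : 0 < k.+1%:R^-1 :> R by rewrite invr_gt0.
have qx i : exists q : rat, `|ratr q - x 0 i| < k.+1%:R^-1.
  have /rat_in_itvoo[q] : x 0 i - k.+1%:R^-1 < x 0 i + k.+1%:R^-1.
    by rewrite ltrD2l (lt_trans _ k0)// oppr_lt0.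
  by rewrite in_itv/= => qx; exists q; rewrite ltr_distl.
have {qx}[q qx] := choice qx.
exists (\row_i q i, k) => /=.
  move=> y [_ qy]; apply: xeU; split=> // i j; rewrite (ord1 i).
  have := qy 0 j; rewrite !mxE /ball/= => qyj.
  rewrite -(subrKA (ratr (q j))) (le_lt_trans (ler_normD _ _))//.
  by rewrite (splitr e) ltrD// ?(lt_trans _ ke)// distrC.
by split=> // i j; rewrite (ord1 i) !mxE /ball/=.
Qed.

Lemma measurable_rVcons n : measurable_fun [set: _] (@rVcons n).
Proof.
apply: (@measurability _ _ _ _ _ _ (@open 'rV[R]_n.+1)) => //.
move=> _ [U oU <-]; rewrite setTI (open_bigcup_rat_ball oU).
rewrite preimage_bigcup bigcup_mkcond.
apply: countable_bigcupT_measurable => // qk; case: ifPn => // _.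
set q := map_mx _ _; set e := _%:R^-1.
have e0 : 0 < e :> R by rewrite invr_gt0.
rewrite (_ : _ @^-1` _ = ball (q 0 0) e `*`
    ball (rsubmx (q : 'rV_(1 + n))) e); last first.
  have l0 : @lshift 1 n 0 = 0 :> 'I_n.+1 by exact/val_inj.
  apply/seteqP; split=> [[x v] [_ /= qxv]|[x v] /= [qx [_ qv]]].
    split=> /=.
      have := qxv 0 (@lshift 1 n 0).
      rewrite /rVcons (@row_mxEl _ 1 1 n) /=.
      by rewrite [(x : R)%:M _ _]mxE eqxx mulr1n l0.
    split=> // i j; have := qxv i (@rshift 1 n j).
    by rewrite /rVcons (@row_mxEr _ 1 1 n) /= [rsubmx _ _ _]mxE.
  split=> // i j; rewrite (ord1 i); case: (@split_ordP 1 n j) => k ->.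
    by rewrite /rVcons (@row_mxEl _ 1 1 n) /= (ord1 k) [(x : R)%:M _ _]mxE eqxx mulr1n l0.
  by have := qv 0 k; rewrite /rVcons (@row_mxEr _ 1 1 n) /= [rsubmx _ _ _]mxE.
apply: measurableX; first exact: measurable_ball.
by apply: open_measurable_mx; exact: ball_open.
Qed.

Lemma rVcons0 n x (v : 'rV[R]_n) : rVcons (x, v) 0 0 = x.
Proof.
rewrite /rVcons (_ : 0 = @lshift 1 n 0) ?(@row_mxEl _ 1 1 n)/=; last first.
  exact/val_inj.
by rewrite [(x : R)%:M _ _]mxE eqxx mulr1n.
Qed.

Lemma rVconsS n x (v : 'rV[R]_n) i : rVcons (x, v) 0 (lift 0 i) = v 0 i.
Proof.
rewrite /rVcons (_ : lift 0 i = @rshift 1 n i) ?(@row_mxEr _ 1 1 n)//.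
exact/val_inj.
Qed.

Definition rVuncons n (w : 'rV[R]_n.+1) : measurableTypeR R * 'rV[R]_n :=
  (w 0 0, rsubmx (w : 'rV[R]_(1 + n))).

Lemma rVconsK n : cancel (@rVcons n) (@rVuncons n).
Proof.
move=> [x v]; rewrite /rVuncons rVcons0; congr pair.
by rewrite /rVcons (@row_mxKr _ 1 1 n).
Qed.

Lemma continuous_measurable_mx m n p q (f : 'M[R]_(m, n) -> 'M[R]_(p, q)) :
  continuous f -> measurable_fun setT f.
Proof.
move=> /continuousP cf.
apply: (@measurability _ _ _ _ _ _ (@open 'M[R]_(p, q))) => //.
by move=> _ [U oU <-]; rewrite setTI; apply: open_measurable_mx; exact: cf.
Qed.

Lemma measurable_coord m n i j :
  measurable_fun setT (fun M : 'M[R]_(m, n) => M i j : measurableTypeR R).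
Proof.
apply: (measurability _ (RGenOpens.measurableE R)).
move=> _ [_ [a [b ->] <-]]; rewrite setTI; apply: open_measurable_mx.
have /continuousP := @coord_continuous R m n i j; apply.
exact: interval_open.
Qed.

Lemma measurable_rVuncons n : measurable_fun setT (@rVuncons n).
Proof.
apply: measurable_fun_pair; first exact: measurable_coord.
by apply: continuous_measurable_mx; exact: (@continuous_rsubmx R 1 1 n).
Qed.

Section step.
Context n (mu : {sigma_finite_measure set 'rV[R]_n -> \bar R}).

Definition lebesgue_rVS : set 'rV[R]_n.+1 -> \bar R :=
  pushforward (lebesgue_measure \x mu)%E (@rVcons n).

Let lebesgue_rVS0 : lebesgue_rVS set0 = 0%E.
Proof. by rewrite /lebesgue_rVS /pushforward preimage_set0 measure0. Qed.

Let lebesgue_rVS_ge0 A : (0 <= lebesgue_rVS A)%E.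
Proof.
have mf := @measurable_rVcons n.
by rewrite /lebesgue_rVS; exact: measure_ge0.
Qed.

Let lebesgue_rVS_sigma_additive : semi_sigma_additive lebesgue_rVS.
Proof.
have mf := @measurable_rVcons n.
by rewrite /lebesgue_rVS; exact: measure_semi_sigma_additive.
Qed.

HB.instance Definition _ := isMeasure.Build _ _ _ lebesgue_rVS
  lebesgue_rVS0 lebesgue_rVS_ge0 lebesgue_rVS_sigma_additive.

Let lebesgue_rVS_sigma_finite : sigma_finite setT lebesgue_rVS.
Proof.
have [F FT Foo] : sigma_finite setT (@lebesgue_measure R \x mu)%E.
  have /sigma_finiteP[F [TF ndF Foo]] := sigma_finiteT (@lebesgue_measure R).
  have /sigma_finiteP[G [TG ndG Goo]] := sigma_finiteT mu.
  exists (fun k => F k `*` G k).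
    rewrite -setXTT TF TG predeqE => -[x y]; split.
      move=> [/= [j _ Fjx] [k _ Gky]]; exists (maxn j k) => //; split.
      - by move: x Fjx; exact/subsetPset/ndF/leq_maxl.
      - by move: y Gky; exact/subsetPset/ndG/leq_maxr.
    by move=> [k _ []/= ? ?]; split; exists k.
  move=> k; have [? ?] := Foo k; have [? ?] := Goo k.
  split; first exact: measurableX.
  by rewrite product_measure1E// lte_mul_pinfty// ge0_fin_numE.
exists (fun k => (@rVuncons n) @^-1` F k).
  by rewrite -preimage_bigcup -FT preimage_setT.
move=> k; have [mF Fk] := Foo k; split.
  by rewrite -[X in measurable X]setTI; exact: measurable_rVuncons.
rewrite /lebesgue_rVS /pushforward -comp_preimage.
by rewrite (_ : _ \o _ = id)// funeqE; exact: rVconsK.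
Qed.

HB.instance Definition _ := Measure_isSigmaFinite.Build _ _ _ lebesgue_rVS
  lebesgue_rVS_sigma_finite.

End step.

(* n-dimensional Lebesgue measure on the Borel sets of R^n, as the iterated
   product of the one-dimensional one; see lebesgue_rV_box. *)
Fixpoint lebesgue_rV n : {sigma_finite_measure set 'rV[R]_n -> \bar R} :=
  if n is n'.+1 then lebesgue_rVS (lebesgue_rV n') else \d_(0 : 'rV[R]_0).

Lemma lebesgue_rV_box n (a b : 'rV[R]_n) : (forall i, a 0 i <= b 0 i) ->
  lebesgue_rV n [set x : 'rV[R]_n | forall i, a 0 i <= x 0 i <= b 0 i] =
  (\prod_(i < n) (b 0 i - a 0 i))%:E.
Proof.
elim: n a b => [|n ih] a b ab.
  rewrite big_ord0 /= diracE mem_set//.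
  by move=> [].
pose tl (c : 'rV[R]_n.+1) : 'rV[R]_n := rsubmx (c : 'rV_(1 + n)).
have tlE c i : tl c 0 i = c 0 (lift 0 i).
  by rewrite mxE; congr (c _ _); exact/val_inj.
transitivity ((lebesgue_measure \x lebesgue_rV n)%E (`[a 0 0, b 0 0] `*`
    [set x : 'rV[R]_n | forall i, tl a 0 i <= x 0 i <= tl b 0 i])).
  rewrite /= /lebesgue_rVS /pushforward; congr product_measure1.
  apply/seteqP; split=> [[x v] /= abx|[x v] /= [abx abv] i].
    split=> [|i]; last by have := abx (lift 0 i); rewrite rVconsS !tlE.
    by have := abx 0; rewrite rVcons0 in_itv.
  case: (unliftP 0 i) => [j|] ->; last by rewrite rVcons0; rewrite in_itv in abx.
  by rewrite rVconsS -!tlE.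
rewrite product_measure1E//; last first.
  rewrite (_ : mkset _ = \bigcap_(i in [set: 'I_n])
      ((fun x : 'rV[R]_n => x 0 i) @^-1` `[tl a 0 i, tl b 0 i])); last first.
    apply/seteqP; split=> [x abx i _|x abx i]; first by rewrite /= in_itv/= abx.
    by have := abx i Logic.I; rewrite /= in_itv.
  apply: fin_bigcap_measurable => // i _.
  by rewrite -[X in measurable X]setTI; exact: measurable_coord.
rewrite ih => [|i]; last by rewrite !tlE.
rewrite big_ord_recl EFinM; congr (_ * _)%E; last first.
  by congr EFin; apply: eq_bigr => i _; rewrite !tlE.
rewrite [LHS](lebesgue_measure_itv `[a 0 0, b 0 0])/= lte_fin.
by case: ltgtP (ab 0) => // <- _; rewrite subrr.
Qed.

End lebesgue_rV.
Arguments lebesgue_rV {R} n.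

Definition path_connected (R : realType) (T : topologicalType) (X : set T) :=
  forall x y, X x -> X y -> exists g : R -> T,
    [/\ {within `[0, 1], continuous g}, g 0 = x, g 1 = y &
        forall t, t \in `[0, 1] -> X (g t)].
Arguments path_connected R {T} X.

Section optimal_transport.
Context (R : realType) (d : nat).
Local Notation E := 'rV[R]_d.
Implicit Types (rho mu nu : probability E R) (phi : E -> \bar R).

Definition dotv (u v : E) : R := (u *m v^T) 0 0.

(* The Euclidean norm; `|u| is the sup norm. *)
Definition enorm (u : E) : R := Num.sqrt (dotv u u).

Definition coupling mu nu (gamma : probability (E * E)%type R) :=
  (forall A, measurable A -> gamma (A `*` setT) = mu A) /\
  (forall B, measurable B -> gamma (setT `*` B) = nu B).

Definition wasserstein (p : R) mu nu : \bar R :=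
  (ereal_inf [set (\int[gamma]_z ((enorm (z.1 - z.2)) `^ p)%:E)%E |
                gamma in coupling mu nu] `^ p^-1)%E.

Definition transport_map rho mu (T : E -> E) :=
  measurable_fun setT T /\
  forall A, measurable A -> pushforward rho T A = mu A.

(* Optimality is among transport maps (Monge's problem). *)
Definition brenier_map rho mu (T : E -> E) :=
  transport_map rho mu T /\
  forall S, transport_map rho mu S ->
    (\int[rho]_x (enorm (x - T x) ^+ 2)%:E <=
     \int[rho]_x (enorm (x - S x) ^+ 2)%:E)%E.

(* Convexity for functions with values in R `|` {+oo}; convex_function in the
   library is for real-valued functions only. *)
Definition convex_efun phi :=
  (forall x, phi x != -oo%E) /\
  forall x y (t : R), 0 < t < 1 ->
    (phi (t *: x + (1 - t) *: y)%R <= t%:E * phi x + (1 - t)%:E * phi y)%E.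

Definition is_gradient phi (x g : E) :=
  [/\ \forall y \near x, phi y \is a fin_num,
      differentiable (fine \o phi : E -> R^o) x &
      forall v, 'd (fine \o phi : E -> R^o) x v = dotv g v].

(* As a relation: phi is a representative of the class of the Brenier
   potential in L^2(rho). *)
Definition brenier_potential rho mu phi :=
  [/\ lower_semicontinuous phi,
      convex_efun phi,
      measurable_fun setT phi /\ ('N[rho]_2%:E[phi] < +oo)%E,
      exists2 T, brenier_map rho mu T &
        {ae rho, forall x, is_gradient phi x (T x)} &
      (\int[rho]_x phi x = 0)%E].

Definition supported_in_unit_ball mu := mu [set x | enorm x <= 1] = 1%E.

Definition holder_potential_stability rho :=
  exists C q p : R, [/\ 0 < C, 0 < q, 1 <= p &
    forall mu nu phi psi,
      supported_in_unit_ball mu -> supported_in_unit_ball nu ->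
      brenier_potential rho mu phi -> brenier_potential rho nu psi ->
      ('N[rho]_2%:E[phi \- psi] <=
       C%:E * wasserstein p mu nu `^ q)%E].

Definition density rho (f : E -> R) :=
  [/\ measurable_fun setT f, (forall x, 0 <= f x) &
      forall A, measurable A ->
        rho A = (\int[lebesgue_rV d]_(x in A) (f x)%:E)%E].

End optimal_transport.

(* Main.v *)
(** The domain is a row of rooms at x_0 in (r, 3r/2), r = 2^-n, joined by
    corridors of width exp(-1/x_0). For t in the corridor, the convex function
    max(x_0 - t, 0) is a Brenier potential, its gradient e_0 on {x_0 > t} and 0
    elsewhere. Sliding t from one end of a corridor to the other only moves the
    mass of that corridor, which is at most of order exp(-1/r), so the target
    measures are exponentially close; but it shifts one side of the potential
    by r/4 relative to the other, and the rooms on both sides have mass at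
    least of order r, so the centred potentials differ in L^2 by a power
    of r. *)

Require Import Defs.
From HB Require Import structures.
From mathcomp Require Import all_boot all_order all_algebra.
From mathcomp Require Import all_classical all_reals all_analysis.
From mathcomp Require Import measurable_realfun ring lra.

Set Implicit Arguments.
Unset Strict Implicit.
Unset Printing Implicit Defensive.

Import Order.TTheory GRing.Theory Num.Theory.
Import numFieldNormedType.Exports.

Local Open Scope classical_set_scope.
Local Open Scope ring_scope.

(** * Semicontinuity, differentials and the Euclidean norm *)

Lemma lower_semicontinuous_EFin (R : realType) (T : topologicalType) (g : T -> R) :
  continuous g -> lower_semicontinuous (EFin \o g).
Proof.
move=> /continuousP cg; apply/lower_semicontinuousP => a.
rewrite (_ : mkset _ = g @^-1` [set y : R | (a < y)%R])//.
exact: cg [set y : R | (a < y)%R] (@open_gt R a).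
Qed.

(** The first-order expansion of [f] at [x] is also one of [g], and differentials are unique. This
    lets a ramp, which is only locally affine, inherit the differential of an affine function. *)
Lemma near_eq_differential (R : realType) (V W : normedModType R) (f g : V -> W) x :
  differentiable f x -> (\forall y \near x, f y = g y) ->
  differentiable g x /\ 'd g x = 'd f x :> (V -> W).
Proof.
move=> df fg.
have cdf := diff_continuous df.
have gE : g \o shift x = cst (g x) + 'd f x +o_ 0 id.
  apply/eqaddoP => e e0.
  have /eqaddoP/(_ e e0) := diff_locally df.
  have fg0 : \forall h \near 0, f (h + x) = g (h + x).
    by have := fg; rewrite (near_shift 0 x)/=; apply: filterS => h; rewrite subr0.
  have fgx : f x = g x by exact: nbhs_singleton fg.
  by apply: filterS2 fg0 => h fgh; rewrite /= !fctE /= fgx fgh.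
have dg := diff_unique cdf gE.
by split=> //; apply/diff_locallyP; rewrite dg.
Qed.

Lemma differential_coord (R : realType) (n : nat) (x : 'rV[R]_n) i :
  differentiable (fun y : 'rV[R]_n => y 0 i : R^o) x /\
  'd (fun y : 'rV[R]_n => y 0 i : R^o) x = (fun v => v 0 i) :> ('rV[R]_n -> R^o).
Proof.
have @f : {linear 'rV[R]_n -> R^o}.
  by exists (fun N : 'rV[R]_n => N 0 i); do 2![eexists]; do ?[constructor];
     rewrite ?mxE// => ? *; rewrite ?mxE//; move=> ?; rewrite !mxE.
rewrite (_ : (fun _ => _) = f)//.
have cf : continuous f by exact: coord_continuous.
by split; [exact: linear_differentiable|exact: diff_lin].
Qed.

Lemma dotvE (R : realType) (n : nat) (u v : 'rV[R]_n) : dotv u v = \sum_i u 0 i * v 0 i.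
Proof. by rewrite /dotv mxE; apply: eq_bigr => i _; rewrite mxE. Qed.

Lemma sqr_enorm (R : realType) (n : nat) (u : 'rV[R]_n) : enorm u ^+ 2 = dotv u u.
Proof.
by rewrite sqr_sqrtr// dotvE; apply: sumr_ge0 => i _; rewrite -expr2 sqr_ge0.
Qed.

Lemma enorm0 (R : realType) (n : nat) : enorm (0 : 'rV[R]_n) = 0.
Proof. by rewrite /enorm /dotv mul0mx mxE sqrtr0. Qed.

(** * Ramp functions: convexity and gradients *)

Section ramp.
Context (R : realType) (d : nat).
Local Notation E := 'rV[R]_d.+1.
Implicit Types (c : R) (x y : E).

Definition ramp c x : R := Num.max (x 0 0 - c) 0.

Definition step c x : E := if c < x 0 0 then delta_mx 0 0 else 0.

Lemma dotv_delta v : dotv (delta_mx 0 0 : E) v = v 0 0.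
Proof.
rewrite dotvE (bigD1 0)//= big1 ?addr0 ?mxE ?eqxx ?mul1r// => i i0.
by rewrite mxE (negbTE i0) andbF mul0r.
Qed.

Lemma enorm_delta : enorm (delta_mx 0 0 : E) = 1.
Proof. by rewrite /enorm dotv_delta mxE eqxx sqrtr1. Qed.

Lemma sqr_enorm_sub_delta x :
  enorm (x - delta_mx 0 0) ^+ 2 = enorm x ^+ 2 + (1 - 2 * x 0 0).
Proof.
rewrite !sqr_enorm !dotvE !(bigD1 ord0 (P := predT))//= !mxE eqxx mulr1n.
rewrite (eq_bigr (fun i => x 0 i * x 0 i)) => [|i i0]; first by ring.
by rewrite !mxE (negbTE i0) andbF subr0.
Qed.

Lemma measurable_step c : measurable_fun setT (step c).
Proof.
apply: measurable_fun_ifT => //=.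
apply: measurable_fun_ltr => //; exact: measurable_coord.
Qed.

(** Registering measurability makes [distribution rho (step c)] a probability measure. *)
HB.instance Definition _ c :=
  isMeasurableFun.Build _ _ E E (step c) (measurable_step c).

Lemma continuous_ramp c : continuous (ramp c : E -> R).
Proof.
move=> x; apply: (@continuous_max _ _ (fun x : E => x 0 0 - c) (fun=> 0)).
  apply: (@continuousB _ _ _ (fun x : E => x 0 0) (fun=> c)).
    exact: coord_continuous.
  exact: cst_continuous.
exact: cst_continuous.
Qed.

Lemma measurable_ramp c : measurable_fun setT (ramp c : E -> R).
Proof.
apply: measurable_maxr => //; apply: measurable_funB => //.
exact: measurable_coord.
Qed.

Lemma convex_efun_ramp c k : convex_efun (fun x => (ramp c x - k)%:E).
Proof.
split=> // x y t /andP[t0 t1]; rewrite -!EFinM -EFinD lee_fin /ramp !mxE.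
(* A ramp is a maximum of two affine functions. Each of them lies below the maximum at [x] and at
   [y], and [nra] combines these bounds with weights [t] and [1 - t]. *)
have [? ?] : x 0 0 - c <= Num.max (x 0 0 - c) 0 /\
  0 <= Num.max (x 0 0 - c) 0 by rewrite !le_max !lexx orbT.
have [? ?] : y 0 0 - c <= Num.max (y 0 0 - c) 0 /\
  0 <= Num.max (y 0 0 - c) 0 by rewrite !le_max !lexx orbT.
rewrite lerBlDr ge_max; apply/andP; split; nra.
Qed.

(** Off the hyperplane x_0 = c, the shifted ramp agrees near [x] with a constant or with y_0 - (c +
    k), whose differentials are explicit. *)
Lemma is_gradient_ramp c k x :
  x 0 0 != c -> is_gradient (fun x => (ramp c x - k)%:E) x (step c x).
Proof.
move=> xc.
have cx : (fun y : E => y 0 0) @ x --> x 0 0 by exact: coord_continuous.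
have [dv dvE] := differential_coord x 0.
have gradE (f : E -> R^o) : differentiable f x ->
    (forall v, 'd f x v = dotv (step c x) v) ->
    (\forall y \near x, f y = ramp c y - k) ->
    is_gradient (fun x => (ramp c x - k)%:E) x (step c x).
  move=> df dfE fE.
  have [|dg dgE] := @near_eq_differential _ _ _ f
    (fine \o (fun x : E => (ramp c x - k)%:E) : E -> R^o) x df.
    exact: fE.
  by split=> [|//|v]; [exact: (@filterE _ _ (nbhs_filter x))|rewrite dgE dfE].
case: (ltgtP (x 0 0) c) xc => // xc _.
- apply: (gradE (cst (- k))).
  + exact: differentiable_cst.
  + by move=> v; rewrite diff_cst /step ltNge (ltW xc)/= /dotv mul0mx mxE.
  + have := cx _ (open_nbhs_nbhs (conj (@open_lt R c) xc)).
    apply: (@filterS _ _ (nbhs_filter x)) => y /= yc.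
    by rewrite /ramp (max_idPr _) ?sub0r// subr_le0 ltW.
- have dc : differentiable (cst (c + k) : E -> R^o) x.
    exact: differentiable_cst.
  apply: (gradE ((fun y : E => y 0 0 : R^o) - cst (c + k))).
  + exact: differentiableB.
  + move=> v; rewrite diffB// dvE diff_cst /step xc dotv_delta.
    exact: subr0.
  + have := cx _ (open_nbhs_nbhs (conj (@open_gt R c) xc)).
    apply: (@filterS _ _ (nbhs_filter x)) => y /= yc.
    by rewrite /ramp (max_idPl _) ?subr_ge0 ?ltW// !fctE opprD addrA.
Qed.

End ramp.

(** * Measurability of distances, and optimality of the step maps *)

Lemma measurable_sqr_enorm_sub (R : realType) d (T : measurableType d) (n : nat)
    (f g : T -> 'rV[R]_n) :
  measurable_fun setT f -> measurable_fun setT g ->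
  measurable_fun setT (fun x => enorm (f x - g x) ^+ 2).
Proof.
move=> mf mg; under eq_fun do rewrite sqr_enorm dotvE.
apply: measurable_sum => i; under eq_fun do rewrite !mxE.
have mc (h : T -> 'rV[R]_n) : measurable_fun setT h ->
    measurable_fun setT (fun x => h x 0 i).
  exact: (measurableT_comp (measurable_coord 0 i)).
by apply: measurable_funM; apply: measurable_funB; exact: mc.
Qed.

Lemma measurable_enorm_sub (R : realType) d (T : measurableType d) (n : nat)
    (f g : T -> 'rV[R]_n) :
  measurable_fun setT f -> measurable_fun setT g ->
  measurable_fun setT (fun x => enorm (f x - g x)).
Proof.
move=> mf mg.
have enormE u : enorm (u : 'rV[R]_n) = Num.sqrt (enorm u ^+ 2).
  by rewrite sqrtr_sqr ger0_norm// sqrtr_ge0.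
under eq_fun do rewrite enormE.
have ms : measurable_fun setT (Num.sqrt : R -> R).
  exact: continuous_measurable_fun (@sqrt_continuous R).
exact: (measurableT_comp ms (measurable_sqr_enorm_sub mf mg)).
Qed.

Lemma measurable_set1_mx (R : realType) m n (a : 'M[R]_(m, n)) :
  measurable [set a].
Proof.
rewrite -(setCK [set a]); apply: measurableC; apply: open_measurable_mx.
apply: closed_openC; apply: accessible_closed_set1.
exact/hausdorff_accessible/norm_hausdorff.
Qed.

Section step_transport.
Context (R : realType) (d : nat).
Local Notation E := 'rV[R]_d.+1.
Context (rho : probability E R).
Implicit Types (c : R).

Let delta_neq0 : delta_mx 0 0 != 0 :> E.
Proof.
by apply/eqP => /matrixP/(_ 0 0)/eqP; rewrite !mxE !eqxx oner_eq0.
Qed.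

Lemma measurable_gt_coord0 c : measurable [set x : E | c < x 0 0].
Proof.
rewrite -[X in measurable X]setTI.
exact: (measurable_fun_ltr (measurable_cst c) (measurable_coord 0 0)) [set true] _.
Qed.

Lemma measurable_le_coord0 c : measurable [set x : E | x 0 0 <= c].
Proof.
have -> : [set x : E | x 0 0 <= c] = ~` [set x : E | c < x 0 0].
  by apply/seteqP; split=> x /=; rewrite leNgt => /negP.
by apply: measurableC; exact: measurable_gt_coord0.
Qed.

Lemma measurable_coord0_itv (l u : R) : measurable [set x : E | l < x 0 0 <= u].
Proof.
have -> : [set x : E | l < x 0 0 <= u] =
    [set x | l < x 0 0] `\` [set x | u < x 0 0].
  apply/seteqP; split=> x /=.
    by move=> /andP[-> xu]; split=> //; apply/negP; rewrite -leNgt.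
  by move=> [-> /negP]; rewrite -leNgt.
by apply: measurableD; exact: measurable_gt_coord0.
Qed.

(* The weak Kantorovich inequality for the ramp reads
     |x - T x|^2 + (1 - 2c) 1_B <= |x - S x|^2 + (1 - 2c) 1_A
   with A = {T = e_0}, B = {S = e_0}, and rho A = rho B since T and S have the
   same image measure. For c <= 1/2 all terms are nonnegative, which makes
   integration unconditional. *)
Lemma brenier_map_step c : c <= 2^-1 ->
  brenier_map rho (distribution rho (step c)) (step c).
Proof.
move=> c2; split=> [|S [mS SE]]; first by split.
pose A := [set x : E | c < x 0 0].
pose B := S @^-1` [set delta_mx 0 0].
have mA : measurable A by exact: measurable_gt_coord0.
have mpre D : measurable D -> measurable (S @^-1` D).
  by move=> mD; rewrite -[X in measurable X]setTI; exact: mS.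
have mB : measurable B by apply: mpre; exact: measurable_set1_mx.
have rhoAB : rho A = rho B.
  transitivity (distribution rho (step c) [set delta_mx 0 0]); last first.
    by rewrite -SE//; exact: measurable_set1_mx.
  rewrite /distribution /pushforward; congr (rho _).
  apply/seteqP; split=> x; rewrite /A /= /step; first by move=> ->.
  by case: ifPn => // _ /esym/eqP; rewrite (negbTE delta_neq0).
(* [S] pushes [rho] to the same measure as [step c], which gives no mass to the complement of {0,
   e_0}; hence the preimage of that complement under [S] is null. *)
have S01 : {ae rho, forall x, S x = 0 \/ S x = delta_mx 0 0}.
  pose D : set E := ~` ([set 0] `|` [set delta_mx 0 0]).
  have mD : measurable D.
    by apply: measurableC; exact: measurableU (measurable_set1_mx _) (measurable_set1_mx _).
  exists (S @^-1` D); split; first exact: mpre.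
  - rewrite -[LHS]/(pushforward rho S _) SE//.
    rewrite /distribution /pushforward -[RHS](measure0 rho); congr (rho _).
    apply/seteqP; split=> x//=; rewrite /step.
    by case: ifP => _ []; [right|left].
  - by move=> x /=.
have k0 : 0 <= 1 - 2 * c by lra.
have int1 D : measurable D ->
    (\int[rho]_x ((1 - 2 * c) * \1_D x)%:E = (1 - 2 * c)%:E * rho D)%E.
  move=> mD; under eq_integral do rewrite EFinM.
  rewrite ge0_integralZl//; last exact/measurable_EFinP.
  by rewrite integral_indic// setIT.
have mE (f : E -> E) : measurable_fun setT f ->
    measurable_fun setT (fun x : E => (enorm (x - f x) ^+ 2)%:E).
  by move=> mf; apply/measurable_EFinP; exact: measurable_sqr_enorm_sub.
have mI D : measurable D ->
    measurable_fun setT (fun x : E => ((1 - 2 * c) * \1_D x)%:E).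
  by move=> mD; apply/measurable_EFinP; exact: measurable_funM.
have le_int : (\int[rho]_x (enorm (x - step c x) ^+ 2)%:E +
      \int[rho]_x ((1 - 2 * c) * \1_B x)%:E <=
    \int[rho]_x (enorm (x - S x) ^+ 2)%:E +
      \int[rho]_x ((1 - 2 * c) * \1_A x)%:E)%E.
  have ge0_mulI D (x : E) : 0 <= (1 - 2 * c) * \1_D x.
    by rewrite mulr_ge0.
  have ge0_sqr (f : E -> E) x : (0 <= (enorm (x - f x) ^+ 2)%:E)%E.
    by rewrite lee_fin sqr_ge0.
  rewrite -!ge0_integralD//; try exact: mE; try exact: mI;
    try by move=> x _; rewrite lee_fin ?ge0_mulI ?sqr_ge0.
  apply: ae_ge0_le_integral => //.
  - by move=> x _; rewrite adde_ge0 ?lee_fin ?sqr_ge0 ?ge0_mulI.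
  - apply: emeasurable_funD; [apply: mE|exact: mI].
    exact: measurable_step.
  - by move=> x _; rewrite adde_ge0 ?lee_fin ?sqr_ge0 ?ge0_mulI.
  - by apply: emeasurable_funD; [exact: mE|exact: mI].
  apply: filterS S01 => x Sx _; rewrite -!EFinD lee_fin !indicE.
  have -> : (x \in A) = (c < x 0 0) by apply/idP/idP; rewrite inE.
  have -> : (x \in B) = (S x == delta_mx 0 0).
    by apply/idP/eqP; rewrite inE.
  rewrite /step; case: Sx => ->; rewrite ?eqxx 1?eq_sym ?(negbTE delta_neq0);
    by case: ltP => xc; rewrite ?subr0 ?sqr_enorm_sub_delta ?mulr0 ?mulr1; lra.
(* The two correction terms are equal and finite, so they cancel. *)
move: le_int; rewrite !int1// rhoAB leeD2rE// fin_numM//.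
exact: fin_num_measure.
Qed.

End step_transport.

(** * Ramps as Brenier potentials: distance of the targets, distance of the potentials *)

Section ramp_potential.
Context (R : realType) (d : nat).
Local Notation E := 'rV[R]_d.+1.
Context (rho : probability E R).
Implicit Types (c : R).

(** The image of [rho] under x -> (step c x, step c' x) is a coupling. The two points differ only
    when c < x_0 <= c', and then their distance is 1. *)
Lemma wasserstein_step_le (p c c' : R) : 1 <= p -> c <= c' ->
  (wasserstein p (distribution rho (step c)) (distribution rho (step c')) <=
   rho [set x : E | (c < x 0 0 <= c')%R] `^ p^-1)%E.
Proof.
move=> p1 cc'; have p0 : 0 < p by lra.
have mst : measurable_fun setT (fun x : E => (step c x, step c' x)).
  by apply: measurable_fun_pair; exact: measurable_step.
pose st : {mfun E >-> (E * E)%type} := HB.pack (fun x : E => (step c x, step c' x))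
  (isMeasurableFun.Build _ _ _ _ _ mst).
set A := [set x : E | _].
have mA : measurable A by exact: measurable_coord0_itv.
apply: gt0_ler_poweR.
- by rewrite invr_ge0 ltW.
- rewrite in_itv/= leey andbT; apply: le_ereal_inf_tmp => _ [gamma _ <-].
  by apply: integral_ge0 => x _; rewrite lee_fin powR_ge0.
- by rewrite in_itv/= leey andbT.
have mn : measurable_fun setT (fun z : E * E => (enorm (z.1 - z.2) `^ p)%:E).
  apply/measurable_EFinP; apply: (measurableT_comp (measurable_powR p)).
  exact: measurable_enorm_sub.
apply: ge_ereal_inf; eexists.
  exists (distribution rho st) => //.
  by split=> D mD; rewrite /distribution /pushforward; congr (rho _);
    apply/seteqP; split=> x //= [].
rewrite le_eqVlt; apply/orP; left; apply/eqP.
rewrite /distribution ge0_integral_pushforward//=; last first.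
  by move=> z _; rewrite lee_fin powR_ge0.
rewrite -[in RHS](setIT A) -integral_indic//; apply: eq_integral => x _ /=.
rewrite indicE; congr EFin.
have -> : (x \in A) = (c < x 0 0 <= c') by apply/idP/idP; rewrite inE.
(* Off [A] the integrand is 0 to the power [p], which is 0 because [p] is nonzero. *)
rewrite /step; case: (ltP c' (x 0 0)) => xc'.
  by rewrite (le_lt_trans cc' xc')/= subrr enorm0 powR0// gt_eqF.
by case: ifP => _; rewrite subr0 ?enorm_delta ?powR1// enorm0 powR0// gt_eqF.
Qed.

Lemma ae_bounded_integral_lty (g : E -> R) K :
  measurable_fun setT g -> {ae rho, forall x, `|g x| <= K} ->
  (\int[rho]_x `|g x|%:E < +oo)%E.
Proof.
move=> mg gK; apply: (@le_lt_trans _ _ (\int[rho]_x `|K|%:E)%E); last first.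
  by rewrite integral_cst//= probability_setT mule1 ltry.
apply: ae_ge0_le_integral => //.
- by apply/measurable_EFinP; exact: measurableT_comp.
- apply: filterS gK => x gK _; rewrite lee_fin.
  exact: le_trans gK (ler_norm _).
Qed.

Hypothesis rho01 : {ae rho, forall x : E, 0 < x 0 0 < 1}.

Lemma integrable_ramp c : 0 <= c -> rho.-integrable setT (EFin \o ramp c).
Proof.
move=> c0; apply/integrableP; split.
  by apply/measurable_EFinP; exact: measurable_ramp.
apply: (@ae_bounded_integral_lty _ 1); first exact: measurable_ramp.
apply: filterS rho01 => x /andP[x0 x1].
rewrite ger0_norm ?le_max ?lexx ?orbT// ge_max ler01 andbT; lra.
Qed.

Definition mean_ramp c : R := fine (\int[rho]_x (ramp c x)%:E).

Definition ramp_potential c (x : E) : \bar R := (ramp c x - mean_ramp c)%:E.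

(** The bound c <= 1/2 gives optimality of [step c], c >= 0 keeps the ramp in [0, 1] almost
    everywhere, and the hyperplane x_0 = c must be null because the ramp has a kink there. *)
Lemma brenier_potential_ramp c : 0 <= c <= 2^-1 ->
  rho [set x : E | x 0 0 = c] = 0%E ->
  brenier_potential rho (distribution rho (step c)) (ramp_potential c).
Proof.
move=> /andP[c0 c2] rhoc.
have mg : measurable_fun setT (fun x : E => ramp c x - mean_ramp c).
  by apply: measurable_funB => //; exact: measurable_ramp.
split.
- apply: (@lower_semicontinuous_EFin _ _ (fun x : E => ramp c x - mean_ramp c)).
  by move=> x; apply: continuousB; [exact: continuous_ramp|exact: cst_continuous].
- exact: convex_efun_ramp.
- split; first exact/measurable_EFinP.
  rewrite unlock; apply: poweR_lty.
  under eq_integral => x _ do rewrite /= powR_mulrn//.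
  rewrite (eq_integral (fun x => `| (ramp c x - mean_ramp c) ^+ 2|%:E)); last first.
    by move=> x _; rewrite normrX.
  apply: (@ae_bounded_integral_lty (fun x => (ramp c x - mean_ramp c) ^+ 2)
    ((1 + `|mean_ramp c|) ^+ 2)).
    exact: measurable_funX.
  apply: filterS rho01 => x /andP[x0 x1].
  rewrite normrX ler_sqr ?nnegrE// ?addr_ge0//.
  apply: le_trans (ler_normB _ _) _; rewrite lerD2r.
  rewrite ger0_norm ?le_max ?lexx ?orbT// ge_max ler01 andbT; lra.
- exists (step c); first exact: brenier_map_step.
  exists [set x : E | x 0 0 = c]; split => //.
    rewrite -[X in measurable X]setTI.
    exact: (measurable_coord 0 0) measurableT [set c] (measurable_set1 c).
  move=> x /= nx; apply: contrapT => /eqP xc; apply: nx.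
  exact: is_gradient_ramp.
- have ir := integrable_ramp c0.
  have ik : rho.-integrable setT (EFin \o cst (mean_ramp c)).
    exact: finite_measure_integrable_cst.
  rewrite (eq_integral (fun x => (ramp c x)%:E - (mean_ramp c)%:E)%E)//.
  rewrite (integralB_EFin measurableT ir ik) /=.
  have -> : (\int[rho]_x (mean_ramp c)%:E = (mean_ramp c)%:E)%E.
    by rewrite integral_cst//= probability_setT mule1.
  by rewrite fineK ?subee//; exact: integrable_fin_num ir.
Qed.

(* The difference of the potentials is constant on each of the two half-spaces,
   and the two constants differ by c' - c, so one of them is at least
   (c' - c) / 2 in absolute value. *)
Lemma Lnorm_ramp_potential_ge (c c' w : R) : 0 <= w -> c <= c' ->
  (w%:E <= rho [set x : E | (x 0 0 <= c)%R])%E ->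
  (w%:E <= rho [set x : E | (c' < x 0 0)%R])%E ->
  (((c' - c) ^+ 2 / 4 * w)%:E <=
    'N[rho]_2%:E[(ramp_potential c \- ramp_potential c')%E] `^ 2)%E.
Proof.
move=> w0 cc' wL wR; rewrite poweR_Lnorm//.
(* The difference of the potentials is [a] where x_0 <= c and c' - c + a where x_0 > c'. By [key],
   it suffices that one of these constants is at least (c' - c) / 2 in absolute value. *)
pose a := mean_ramp c' - mean_ramp c.
have key (D : set E) (b : R) : measurable D -> (w%:E <= rho D)%E ->
    (forall x, D x -> ramp c x - ramp c' x + a = b) -> (c' - c) / 2 <= `|b| ->
    (((c' - c) ^+ 2 / 4 * w)%:E <=
     \int[rho]_x (`|(ramp_potential c \- ramp_potential c') x| `^ 2))%E.
  move=> mD wD Db bge.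
  apply: (@le_trans _ _ (\int[rho]_x ((c' - c) ^+ 2 / 4 * \1_D x)%:E)%E).
    under eq_integral do rewrite EFinM.
    rewrite ge0_integralZl//; last 2 first.
    - exact/measurable_EFinP.
    - by rewrite lee_fin divr_ge0 ?sqr_ge0.
    by rewrite integral_indic// setIT EFinM lee_pmul// lee_fin// divr_ge0 ?sqr_ge0.
  apply: ge0_le_integral => //.
  - by move=> x _; rewrite lee_fin mulr_ge0 ?divr_ge0 ?sqr_ge0.
  - by apply/measurable_EFinP; exact: measurable_funM.
  - have -> : (fun x => `|(ramp_potential c \- ramp_potential c') x| `^ 2)%E =
        (fun x => (`|(ramp c x - mean_ramp c) - (ramp c' x - mean_ramp c')| `^ 2)%:E).
      exact/funext.
    apply/measurable_EFinP.
    under eq_fun do rewrite powR_mulrn//.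
    apply: measurable_funX; apply: measurableT_comp => //.
    by apply: measurable_funB; apply: measurable_funB => //; exact: measurable_ramp.
  - move=> x _; rewrite /= powR_mulrn// lee_fin indicE.
    have [/set_mem Dx|_] := boolP (x \in D); last by rewrite mulr0 sqr_ge0.
    rewrite (_ : _ - _ - (_ - _) = b); last by rewrite -(Db x Dx) /a; ring.
    rewrite mulr1 (_ : _ / 4 = ((c' - c) / 2) ^+ 2); last by field.
    by rewrite ler_sqr// nnegrE divr_ge0// subr_ge0.
have [ha|ha] := leP ((c' - c) / 2) `|a|.
  have mL : measurable [set x : E | x 0 0 <= c] by exact: measurable_le_coord0.
  apply: (key _ a mL wL) => //.
  move=> x /= xc; rewrite /ramp !max_r; last 2 first.
  - by rewrite subr_le0 (le_trans xc).
  - by rewrite subr_le0.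
  by rewrite subrr add0r.
apply: (key _ (c' - c + a) (measurable_gt_coord0 c') wR).
- move=> x /= xc'; rewrite /ramp !max_l; first by ring.
    by rewrite subr_ge0 ltW.
  by rewrite subr_ge0 ltW// (le_lt_trans cc').
- move: ha; rewrite ltr_norml => /andP[a1 a2].
  by rewrite ger0_norm; lra.
Qed.

End ramp_potential.

(** * Mass of sets under a density bounded above and below on its domain *)

Section density_bounds.
Context (R : realType) (d : nat).
Local Notation E := 'rV[R]_d.
Context (rho : probability E R) (f : E -> R) (X : set E) (m M : R).
Hypotheses (mX : measurable X) (rhof : density rho f).
Hypotheses (f0 : forall x, ~ X x -> f x = 0) (m0 : 0 < m) (M0 : 0 < M).
Hypothesis fmM : forall x, X x -> m <= f x <= M.
Implicit Types a b : E.

Definition box a b := [set x : E | forall i, a 0 i <= x 0 i <= b 0 i].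

Lemma measurable_box a b : measurable (box a b).
Proof.
rewrite (_ : box a b = \bigcap_(i in [set: 'I_d])
    ((fun x : E => x 0 i) @^-1` `[a 0 i, b 0 i])); last first.
  apply/seteqP; split=> [x abx i _|x abx i]; first by rewrite /= in_itv/= abx.
  by have := abx i Logic.I; rewrite /= in_itv.
apply: fin_bigcap_measurable => // i _.
by rewrite -[X in measurable X]setTI; exact: measurable_coord.
Qed.

Lemma density_setC0 : rho (~` X) = 0%E.
Proof.
have [mf f_ge0 ->] := rhof; last exact: measurableC.
by rewrite integral0_eq// => x Xx; rewrite f0.
Qed.

Lemma density_box_ge a b : (forall i, a 0 i <= b 0 i) -> box a b `<=` X ->
  ((m * \prod_(i < d) (b 0 i - a 0 i))%:E <= rho (box a b))%E.
Proof.
move=> ab abX; have [mf f_ge0 ->] := rhof; last exact: measurable_box.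
rewrite EFinM -lebesgue_rV_box//.
rewrite -(integral_cst (lebesgue_rV d) (measurable_box a b)).
apply: ge0_le_integral => //.
- exact: measurable_box.
- by move=> x _; rewrite lee_fin ltW.
- by apply/measurable_EFinP; exact: measurable_funTS.
- by move=> x /abX/fmM/andP[]; rewrite lee_fin.
Qed.

(** Since [f] vanishes off [X], it is at most [M] times the indicator of the box on all of [A], even
    where [A] leaves the box. *)
Lemma density_box_le (A : set E) a b : measurable A ->
  (forall i, a 0 i <= b 0 i) -> A `&` X `<=` box a b ->
  (rho A <= (M * \prod_(i < d) (b 0 i - a 0 i))%:E)%E.
Proof.
move=> mA ab AX; have [mf f_ge0 ->//] := rhof.
have mB := measurable_box a b.
rewrite EFinM -lebesgue_rV_box// -/(box a b).
apply: (@le_trans _ _ (\int[lebesgue_rV d]_(x in A) (M * \1_(box a b) x)%:E)%E).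
  apply: ge0_le_integral => //.
  - by move=> x _; rewrite lee_fin.
  - by apply/measurable_EFinP; exact: measurable_funTS.
  - by apply/measurable_EFinP; apply: measurable_funM.
  - move=> x Ax; rewrite lee_fin.
    have [Xx|/f0 ->] := pselect (X x); last by rewrite mulr_ge0 // ltW.
    rewrite indicE mem_set ?mulr1; last exact: AX.
    by have /andP[] := fmM Xx.
under eq_integral do rewrite EFinM.
rewrite ge0_integralZl//; last 2 first.
- apply/measurable_EFinP; apply: measurable_funTS; exact: measurable_indic.
- by rewrite lee_fin ltW.
rewrite integral_indic// lee_pmul2l// ?lte_fin//.
by apply: le_measure; rewrite ?inE//; exact: measurableI.
Qed.

End density_bounds.

(** * The domain of rooms and corridors: open, bounded and path-connected *)

Lemma cvg_rV (R : realType) (T : topologicalType) (n : nat)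
    (g : T -> 'rV[R]_n) (t : T) :
  (forall i, (fun u => g u 0 i) @ t --> g t 0 i) -> g @ t --> g t.
Proof.
move=> gi; apply/cvg_ballP => e e0.
have : \forall u \near t, forall i, ball (g t 0 i) e (g u 0 i).
  by apply: filter_forall => i; exact: (cvg_ball (gi i)).
by apply: filterS => u gu; split=> // i j; rewrite (ord1 i).
Qed.

Section domain.
Context (R : realType) (d : nat).
Local Notation E := 'rV[R]_d.+1.
Implicit Types (s : R) (x y : E).

Definition in_room s := exists2 n, (0 < n)%N &
  2^-1 ^+ n < s < 3 / 2 * 2^-1 ^+ n.

Definition width s : R := if `[< in_room s >] then 1 else expR (- s^-1).

Definition rooms_domain := [set x : E |
  0 < x 0 0 < 1 /\ forall i, i != 0 -> `|x 0 i| < width (x 0 0)].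

Lemma width_le1 s : 0 < s -> width s <= 1.
Proof.
move=> s0; rewrite /width; case: ifP => // _.
by rewrite -expR0 ler_expR oppr_le0 invr_ge0 ltW.
Qed.

Lemma expR_le_width s : 0 < s -> expR (- s^-1) <= width s.
Proof.
move=> s0; rewrite /width; case: ifP => // _.
by rewrite -expR0 ler_expR oppr_le0 invr_ge0 ltW.
Qed.

Lemma width_gt0 s : 0 < s -> 0 < width s.
Proof. by move=> s0; exact: lt_le_trans (expR_gt0 _) (expR_le_width s0). Qed.

(** This is lower semicontinuity of [width], which jumps at the ends of the rooms; it is what makes
    the domain open. Rooms are open intervals where the width is 1; elsewhere the width is the
    continuous function exp(-1/s), which is a lower bound for it everywhere. *)
Lemma width_gt_near s v : 0 < s -> v < width s ->
  \forall t \near s, v < width t.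
Proof.
move=> s0; have [[n n0 /andP[ns sn]]|nr] := pselect (in_room s).
  have rn t : 2^-1 ^+ n < t < 3 / 2 * 2^-1 ^+ n -> width t = 1.
    by move=> tn; rewrite /width asboolT//; exists n.
  rewrite rn ?ns// => v1; near=> t; rewrite rn//; apply/andP; split; near: t.
    exact: lt_nbhsr.
  exact: lt_nbhsl.
rewrite {1}/width asboolF// => vs.
have ct : (fun t => expR (- t^-1)) @ s --> expR (- s^-1).
  apply: continuous_cvg; first exact: continuous_expR.
  by apply: cvgN; apply: cvgV; [rewrite gt_eqF|exact: cvg_id].
near=> t.
have t0 : 0 < t by near: t; exact: lt_nbhsr.
apply: lt_le_trans (expR_le_width t0).
by near: t; exact: (cvgr_gt _ ct).
Unshelve. all: by end_near. Qed.

Lemma open_rooms_domain : open rooms_domain.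
Proof.
have cc i x : (fun y : E => y 0 i) @ x --> x 0 i by exact: coord_continuous.
rewrite openE => x [/andP[x0 x1] xw].
have FF := nbhs_filter x.
have y0 : \forall y \near x, 0 < (y : E) 0 0 by exact: (cvgr_gt _ (cc 0 x)).
have y1 : \forall y \near x, (y : E) 0 0 < 1 by exact: (cvgr_lt _ (cc 0 x)).
have yw : \forall y \near x, forall i, i != 0 -> `|(y : E) 0 i| < width ((y : E) 0 0).
  apply: (@filter_forall _ _ (fun i (y : E) => i != 0 -> `|y 0 i| < width (y 0 0)) _ FF) => i.
  have [->|i0] := eqVneq i 0; first exact: filterE.
  (* A value strictly in between separates the two conditions: |y_i| < v and v < width(y_0) each
     hold near [x]. *)
  have [v xv vw] : exists2 v, `|x 0 i| < v & v < width (x 0 0).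
    by exists ((`|x 0 i| + width (x 0 0)) / 2); have := xw i i0; lra.
  have yv : \forall y \near x, `|(y : E) 0 i| < v.
    exact: (cvgr_lt _ (cvg_norm (cc i x))).
  have vy : \forall y \near x, v < width ((y : E) 0 0).
    exact: (cc 0 x) (width_gt_near x0 vw).
  by apply: filterS2 yv vy => y yv vy _; exact: lt_trans vy.
apply: filterS3 y0 y1 yw => y y0 y1 yw; split=> //; exact/andP.
Qed.

Lemma bounded_rooms_domain : bounded_set rooms_domain.
Proof.
exists 1; split=> // M M1 x [/andP[x0 x1] xw].
apply: le_trans (ltW M1); rewrite [leLHS]mx_normrE.
apply/bigmax_leP; split=> // -[i j] _ /=; rewrite (ord1 i).
have [->|j0] := eqVneq j 0; first by rewrite ger0_norm ltW.
exact: le_trans (ltW (xw j j0)) (width_le1 x0).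
Qed.

Lemma rooms_domain_nonempty : rooms_domain !=set0.
Proof.
exists (\row_i (if i == 0 then 2^-1 else 0)); split.
  by rewrite mxE eqxx; apply/andP; split; lra.
by move=> i i0; rewrite !mxE eqxx (negbTE i0) normr0 width_gt0.
Qed.

Lemma path_connected_rooms_domain : path_connected R rooms_domain.
Proof.
move=> x y [/andP[x0 x1] xw] [/andP[y0 y1] yw].
(* Truncation to [0, 1], so that one formula describes a path made of three pieces. *)
pose clamp (t : R) : R := Num.min (Num.max t 0) 1.
have clamp0 t : t <= 0 -> clamp t = 0.
  by move=> t0; rewrite /clamp (max_idPr t0) min_l.
have clamp1 t : 1 <= t -> clamp t = 1.
  by move=> t1; rewrite /clamp max_l ?min_r// (le_trans ler01).
have clamp01 t : 0 <= clamp t <= 1.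
  by rewrite /clamp le_min ge_min le_max !lexx ler01 !orbT.
have cclamp : continuous clamp.
  move=> t; apply: (@continuous_min _ _ (fun t : R => Num.max t 0) (fun=> (1 : R))); last exact: cst_continuous.
  apply: (@continuous_max _ _ (id : R -> R) (fun=> (0:R))); first exact: cvg_id.
    exact: cst_continuous.
(* For t <= 1/3 the transverse coordinates of [x] shrink to 0; for t in [1/3, 2/3] the path follows
   the axis from x_0 to y_0; for t >= 2/3 the transverse coordinates grow to those of [y]. Thus x_0
   moves only on the axis, where narrow corridors are no obstacle. *)
pose g (t : R) : E := \row_i (if i == 0
  then x 0 0 + clamp (3 * t - 1) * (y 0 0 - x 0 0)
  else clamp (1 - 3 * t) * x 0 i + clamp (3 * t - 2) * y 0 i).
exists g; split.
- apply: continuous_subspaceT => t; apply: cvg_rV => i.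
  under eq_fun do rewrite mxE; rewrite mxE.
  have cc a b : (fun t : R => clamp (a * t + b)) @ t --> clamp (a * t + b).
    apply: continuous_cvg; first exact: cclamp.
    by apply: cvgD; [apply: cvgMr; exact: cvg_id|exact: cvg_cst].
  case: eqP => _.
    by apply: cvgD; [exact: cvg_cst|apply: cvgMl; exact: cc].
  apply: cvgD; last by apply: cvgMl; exact: cc.
  apply: cvgMl; under eq_fun do rewrite addrC -mulNr.
  by rewrite addrC -mulNr; exact: cc.
- apply/rowP => i; rewrite mxE mulr0 !sub0r subr0.
  rewrite (clamp0 (- 1)) ?(clamp0 (- 2)) ?clamp1 ?mul0r ?mul1r ?addr0//.
  by case: eqP => // ->.
- apply/rowP => i; rewrite mxE mulr1 clamp1; last lra.
  rewrite clamp0 ?clamp1; try lra.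
  by case: eqP => [->|_]; rewrite mul1r ?mul0r ?add0r// addrC subrK.
- move=> t _.
  have /andP[a0 a1] := clamp01 (3 * t - 1).
  have gt0E : g t 0 0 = x 0 0 + clamp (3 * t - 1) * (y 0 0 - x 0 0).
    by rewrite mxE eqxx.
  have gt0 : 0 < g t 0 0 < 1.
    rewrite gt0E; apply/andP.
    by have [xy|yx] := leP (x 0 0) (y 0 0); split; nra.
  split=> //.
  move=> i i0; rewrite gt0E mxE (negbTE i0).
  have shrink a r w : 0 <= a <= 1 -> `|r| < w -> `|a * r| < w.
    move=> /andP[ha0 ha1] rw; rewrite normrM ger0_norm//.
    by apply: le_lt_trans rw; rewrite ler_piMl.
  have [t1|t1] := leP (3 * t) 1.
    rewrite (clamp0 (3 * t - 1)) ?(clamp0 (3 * t - 2)) ?mul0r ?addr0; try lra.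
    exact: shrink (clamp01 _) (xw i i0).
  rewrite (clamp0 (1 - 3 * t)) ?mul0r ?add0r; last lra.
  have [t2|t2] := leP (3 * t) 2.
    rewrite (clamp0 (3 * t - 2)) ?mul0r ?normr0; last lra.
    by apply: width_gt0; rewrite -gt0E; case/andP: gt0.
  rewrite (clamp1 (3 * t - 1)); last lra.
  by rewrite mul1r (addrC (x 0 0)) subrK; exact: shrink (clamp01 _) (yw i i0).
Qed.

End domain.

(** With y = 2^n, the claim is A y^3 < b exp(a y). As exp(a y) exceeds (a y)^4 / 4!, it is enough
    that y > 24 A / (b a^4), which is the number [z] below. *)
Lemma expR_lt_cube (R : realType) (A a b : R) : 0 <= A -> 0 < a -> 0 < b ->
  exists2 n, (0 < n)%N & A * expR (- (a * (2^-1 ^+ n)^-1)) < b * (2^-1 ^+ n) ^+ 3.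
Proof.
move=> A0 a0 b0; set z := 24 * A / (b * a ^+ 4).
(* The successor ensures 0 < n. *)
exists (Num.bound z).+1 => //; set n := (Num.bound z).+1.
have zn : z < 2 ^+ n by apply: upper_nthrootP; exact: leqnSn.
rewrite exprVn invrK; set y := 2 ^+ n in zn *.
have y0 : 0 < y by rewrite exprn_gt0.
rewrite expRN ltr_pdivrMr ?expR_gt0// exprVn.
have ey : (a * y) ^+ 4 / 24 < expR (a * y).
  (* Index 3 yields the term of degree 4, with denominator 4! = 24. *)
  apply: lt_le_trans (expR_ge1Dxn 3 (ltW (mulr_gt0 a0 y0))).
  by rewrite ltrDr.
rewrite mulrAC ltr_pdivlMr ?exprn_gt0//.
apply: (@le_lt_trans _ _ (b * ((a * y) ^+ 4 / 24))); last by rewrite ltr_pM2l.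
move: zn; rewrite ltr_pdivrMr ?mulr_gt0 ?exprn_gt0// => zn.
have y3 : 0 < y ^+ 3 by rewrite exprn_gt0.
have := zn; rewrite -(ltr_pM2r y3).
have -> : b * ((a * y) ^+ 4 / 24) = y * (b * a ^+ 4) * y ^+ 3 / 24 by field.
lra.
Qed.

(** * Mass of rooms, corridors and hyperplanes *)

Section rooms_domain_measure.
Context (R : realType) (d : nat).
Local Notation E := 'rV[R]_d.+2.
Context (rho : probability E R) (f : E -> R) (m M : R).
Hypotheses (rhof : density rho f) (f0 : forall x, ~ @rooms_domain R d.+1 x -> f x = 0).
Hypotheses (m0 : 0 < m) (M0 : 0 < M).
Hypothesis fmM : forall x, @rooms_domain R d.+1 x -> m <= f x <= M.
Local Notation r n := ((2^-1 : R) ^+ n).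

Let corner (s w : R) : E := \row_i (if i == 0 then s else w).

Let slab_box (l u w : R) : set E := box (corner l (- w)) (corner u w).

Let slab_prod (l u w : R) :
  \prod_(i < d.+2) (corner u w 0 i - corner l (- w) 0 i) =
  (u - l) * (2 * w) ^+ d.+1.
Proof.
rewrite big_ord_recl !mxE eqxx; congr (_ * _).
rewrite (eq_bigr (fun=> 2 * w)) ?prodr_const ?card_ord// => i _.
by rewrite !mxE /= opprK mulrDl mul1r.
Qed.

Let slab_boxP (l u w : R) x : slab_box l u w x <->
  (l <= x 0 0 <= u /\ forall i, i != 0 -> `|x 0 i| <= w).
Proof.
split=> [xb|[x0 xi] i]; last first.
  by rewrite !mxE; case: (eqVneq i 0) => [->//|i0]; rewrite -ler_norml xi.
split; first by have := xb 0; rewrite !mxE eqxx.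
by move=> i i0; have := xb i; rewrite !mxE (negbTE i0) -ler_norml.
Qed.

Let slab_le (l u w : R) : l <= u -> 0 <= w ->
  forall i : 'I_d.+2, corner l (- w) 0 i <= corner u w 0 i.
Proof. by move=> lu w0 i; rewrite !mxE; case: ifP => // _; lra. Qed.

Lemma ae_rooms_domain : {ae rho, forall x : E, rooms_domain x}.
Proof.
have mX : measurable (@rooms_domain R d.+1).
  by apply: open_measurable_mx; exact: open_rooms_domain.
exists (~` (@rooms_domain R d.+1)); split=> //; first exact: measurableC.
exact: density_setC0 mX rhof f0.
Qed.

Lemma hyperplane0 c : rho [set x : E | x 0 0 = c] = 0%E.
Proof.
apply/eqP; rewrite eq_le measure_ge0 andbT.
(* The part of the hyperplane in the domain lies in a slab of zero thickness and half-width 1. *)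
have -> : 0%E = (M * ((c - c) * (2 * 1) ^+ d.+1))%:E by rewrite subrr mul0r mulr0.
rewrite -slab_prod; apply: density_box_le rhof f0 M0 fmM _ _ _ _ (slab_le _ _) _ => //.
  rewrite -[X in measurable X]setTI.
  exact: (measurable_coord 0 0) measurableT [set c] (measurable_set1 c).
move=> x [/= xc [/andP[x0 x1] xw]]; apply/slab_boxP; rewrite xc lexx; split=> // i i0.
exact: le_trans (ltW (xw i i0)) (width_le1 x0).
Qed.

Lemma room_mass_ge n (A : set E) : (0 < n)%N -> measurable A ->
  [set x : E | 9 / 8 * r n <= x 0 0 <= 11 / 8 * r n] `<=` A ->
  ((m * (r n / 4))%:E <= rho A)%E.
Proof.
move=> n0 mA nA; have rn0 : 0 < r n by rewrite exprn_gt0.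
have rn1 : r n <= 2^-1.
  by rewrite -(prednK n0) exprS ler_piMr// exprn_ile1//; lra.
(* The middle part of the room contains a box of length r/4 whose transverse sides all have length
   1. *)
have -> : r n / 4 = (11 / 8 * r n - 9 / 8 * r n) * (2 * 2^-1) ^+ d.+1.
  by rewrite mulfV// expr1n mulr1; field.
rewrite -slab_prod.
apply: (le_trans (density_box_ge rhof m0 fmM (slab_le _ _) _)); [lra|lra| |].
  move=> x /slab_boxP[/andP[x0 x1] xw]; split; first by apply/andP; split; lra.
  move=> i i0; rewrite /width asboolT; first by have := xw i i0; lra.
  by exists n => //; apply/andP; split; lra.
apply: le_measure; rewrite ?inE//; first exact: measurable_box.
by move=> x /slab_boxP[? _]; exact: nA.
Qed.

(** Between two rooms the half-width is exp(-1/x_0) <= exp(-1/r), so the corridor fits in a box with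
    these transverse sides. *)
Lemma corridor_mass_le n : (0 < n)%N ->
  (rho [set x : E | (3 / 2 * r n.+1 < x 0 0 <= r n)%R] <=
   (M * 2 ^+ d.+1 * expR (- (r n)^-1))%:E)%E.
Proof.
move=> n0; have rn0 : 0 < r n by rewrite exprn_gt0.
have rS : r n.+1 = r n / 2 by rewrite exprSr.
set e := expR _; have e0 : 0 < e by exact: expR_gt0.
have e1 : e <= 1 by rewrite -expR0 ler_expR oppr_le0 invr_ge0 ltW.
have rn1 : r n <= 1 by rewrite exprn_ile1//; lra.
apply: (@le_trans _ _ (M * ((r n - 3 / 2 * r n.+1) * (2 * e) ^+ d.+1))%:E); last first.
  (* The length r/4 is at most 1, and e^(d+1) <= e because e <= 1 and there is at least one
     transverse coordinate. *)
  rewrite lee_fin -[leRHS]mulrA ler_pM2l// exprMn -[leRHS]mul1r.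
  apply: ler_pM; [rewrite rS; lra|by rewrite mulr_ge0 ?exprn_ge0// ltW|rewrite rS; lra|].
  by rewrite ler_pM2l ?exprn_gt0// exprS ler_piMr ?exprn_ile1 ?(ltW e0).
rewrite -slab_prod; apply: density_box_le rhof f0 M0 fmM _ _ _ _ (slab_le _ _) _ => //.
- exact: measurable_coord0_itv.
- rewrite rS; lra.
- exact: ltW.
move=> x [/= /andP[x0 x1] [/andP[x2 x3] xw]]; apply/slab_boxP; split.
  by rewrite ltW.
move=> i i0; apply: le_trans (ltW (xw i i0)) _.
rewrite /width asboolF; first by rewrite ler_expR lerN2 lef_pV2.
(* No room meets the corridor: room [k] starts at or beyond r_n if k <= n, and ends at or before
   (3/2) r_(n+1) if k > n. *)
move=> [k k0 /andP[kx xk]].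
have mono p q : (p <= q)%N -> r q <= r p.
  by move=> pq; apply: ler_wiXn2l => //; lra.
have [kn|nk] := leqP k n; first by have := mono _ _ kn; lra.
by have := mono _ _ nk; lra.
Qed.

End rooms_domain_measure.

(** * Failure of Hölder stability: comparison of the two bounds *)

Theorem theorem1p9 (R : realType) (d : nat) (hd : (2 <= d)%N) :
  exists X : set 'rV[R]_d,
    [/\ X !=set0, open X, bounded_set X, path_connected R X &
      forall (rho : probability 'rV[R]_d R) (f : 'rV[R]_d -> R) (m M : R),
        density rho f ->
        (forall x, ~ X x -> f x = 0) ->
        0 < m -> 0 < M -> (forall x, X x -> m <= f x <= M) ->
        ~ holder_potential_stability rho].
Proof.
case: d hd => [|[|d]]// _; exists (@rooms_domain R d.+1); split.
- exact: rooms_domain_nonempty.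
- exact: open_rooms_domain.
- exact: bounded_rooms_domain.
- exact: path_connected_rooms_domain.
move=> rho f m M rhof f0 m0 M0 fmM [C [q [p [C0 q0 p1 stab]]]].
have p0 : 0 < p by lra.
have rho01 : {ae rho, forall x : 'rV[R]_d.+2, 0 < x 0 0 < 1}.
  by apply: filterS (ae_rooms_domain rhof f0) => x [].
(* [K] is the constant of the corridor mass. Squaring C W_p^q with W_p <= (K exp(-1/r))^(1/p)
   produces the exponent s = 2q/p. *)
pose K := M * 2 ^+ d.+1; pose s := p^-1 * q * 2.
have K0 : 0 <= K by rewrite mulr_ge0 ?exprn_ge0// ltW.
have s0 : 0 < s by rewrite !mulr_gt0 ?invr_gt0.
(* The right-hand side is the lower bound for the squared L^2 distance: ((r/4)^2 / 4) (m r/8) = m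
   r^3 / 512, where m r/8 is the mass bound for the smaller room. *)
have [n n0] : exists2 n, (0 < n)%N & C ^+ 2 * K `^ s * expR (- (s * (2^-1 ^+ n)^-1)) <
    m / 512 * (2^-1 ^+ n) ^+ 3.
  have A0 : 0 <= C ^+ 2 * K `^ s by rewrite mulr_ge0 ?sqr_ge0 ?powR_ge0.
  have b0 : 0 < m / 512 by lra.
  exact: expR_lt_cube A0 s0 b0.
set r := 2^-1 ^+ n; set e := expR (- (s * r^-1)) => small.
have r0 : 0 < r by rewrite exprn_gt0.
have r2 : r <= 2^-1.
  by rewrite /r -(prednK n0) exprS ler_piMr// exprn_ile1//; lra.
(* [c] and [r] are the two ends of the corridor between rooms n+1 and n; both are at most 1/2 as n >
   0. *)
pose c := 3 / 2 * (2^-1 : R) ^+ n.+1.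
have rS : 2^-1 ^+ n.+1 = r / 2 by rewrite exprSr.
have cE : c = 3 / 4 * r by rewrite /c rS; field.
have pot t : 0 <= t <= 2^-1 ->
    brenier_potential rho (distribution rho (step t)) (ramp_potential rho t).
  by move=> t01; apply: brenier_potential_ramp => //; exact: hyperplane0 rhof f0 M0 fmM t.
(* The targets are carried by 0 and e_0, both in the closed unit ball. *)
have supp t : supported_in_unit_ball (distribution rho (step t)).
  rewrite /supported_in_unit_ball /distribution /pushforward -(probability_setT rho).
  congr (rho _); apply/seteqP; split=> x //= _.
  by rewrite /step; case: ifP => _; rewrite ?enorm_delta ?enorm0.
have {stab} := stab _ _ _ _ (supp c) (supp r) (pot c _) (pot r _).
have -> : 0 <= c <= 2^-1 by rewrite cE; apply/andP; split; lra.
have -> : 0 <= r <= 2^-1 by rewrite r2 ltW.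
move=> /(_ isT isT) le_N.
have cr : c <= r by rewrite cE; lra.
set N := Lnorm _ _ _ in le_N.
set ey := expR (- r^-1).
have le_W : (wasserstein p (distribution rho (step c)) (distribution rho (step r)) `^ q
    <= ((K * ey) `^ (p^-1 * q))%:E)%E.
  rewrite powRrM -!poweR_EFin; apply: gt0_ler_poweR; first exact: ltW.
  - by rewrite in_itv/= /wasserstein poweR_ge0 leey.
  - by rewrite in_itv/= leey lee_fin powR_ge0.
  apply: le_trans (wasserstein_step_le _ p1 cr) _.
  apply: gt0_ler_poweR; first by rewrite invr_ge0 ltW.
  - by rewrite in_itv/= measure_ge0 leey.
  - by rewrite in_itv/= leey lee_fin mulr_ge0// expR_ge0.
  exact: corridor_mass_le rhof f0 M0 fmM n n0.
have le_NB : (N <= (C * (K * ey) `^ (p^-1 * q))%:E)%E.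
  by apply: le_trans le_N _; rewrite EFinM lee_pmul2l// lte_fin.
have le_N2 : (N `^ 2 <= (C ^+ 2 * K `^ s * e)%:E)%E.
  have -> : C ^+ 2 * K `^ s * e = (C * (K * ey) `^ (p^-1 * q)) `^ 2.
    rewrite powRM ?powR_ge0 ?(ltW C0)// -powRrM powR_mulrn ?(ltW C0)//.
    rewrite powRM ?expR_ge0// -expRM /e -mulrA; congr (_ * (_ * expR _)).
    by rewrite -/s mulNr mulrC.
  rewrite -poweR_EFin; apply: gt0_ler_poweR => //.
  - by rewrite in_itv/= Lnorm_ge0 leey.
  - by rewrite in_itv/= leey lee_fin mulr_ge0 ?powR_ge0 ?ltW.
have : (((r - c) ^+ 2 / 4 * (m * (2^-1 ^+ n.+1 / 4)))%:E <= N `^ 2)%E.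
  apply: Lnorm_ramp_potential_ge => //.
  - by rewrite mulr_ge0 ?(ltW m0)// divr_ge0// exprn_ge0.
  - apply: (room_mass_ge rhof m0 fmM) => //.
    + exact: measurable_le_coord0.
    + move=> x /= /andP[_]; rewrite cE rS; lra.
  - apply: (@le_trans _ _ (m * (r / 4))%:E).
      by rewrite lee_fin ler_pM2l// rS; lra.
    apply: (room_mass_ge rhof m0 fmM) => //; first exact: measurable_gt_coord0.
    move=> x /= /andP[+ _]; rewrite -/r; lra.
(* The lower bound is now at most the squared stability bound, against the choice of [n]. *)
move=> /le_trans/(_ le_N2); rewrite lee_fin leNgt => /negP; apply.
apply: lt_le_trans small _; rewrite cE rS le_eqVlt.
by apply/orP; left; apply/eqP; field.
Qed.
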